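(* Let $k$ be a field not of characteristic $2$, let $W$ be a finite Weyl group with simply laced Dynkin diagram, and let $\mathcal{C}\subseteq W\setminus\{e\}$ be its set of reflections. Then the first noncommutative de Rham cohomology of $W$ for the bicovariant differential calculus on $k(W)$ defined by $\mathcal{C}$ is one-dimensional, spanned by the class of $\theta=\sum_{a\in\mathcal{C}}\omega_a$: \[ H^1_{dR}(W)=k\theta .\] In particular $H^1_{dR}(S_n)=k\theta$ for all $n$, where the symmetric group $S_n$ has the differential calculus defined by the conjugacy class of $2$-cycles.
   Context: Noncommutative de Rham complex in low degree: let $G$ be a finite group and $\mathcal{C}\subseteq G\setminus\{e\}$ a generating subset stable under conjugation and inversion. Let $k(G)$ be the algebra of $k$-valued functions on $G$ and $R_a(f)(x)=f(xa)$. The space $\Omega^1$ is the free left $k(G)$-module with basis $\{\omega_a\}_{a\in\mathcal{C}}$, with right multiplication $\omega_a f=R_a(f)\omega_a$, and $\mathrm{d}:k(G)\to\Omega^1$ is $\mathrm{d}f=\sum_{a\in\mathcal{C}}(R_a(f)-f)\omega_a$. The space $\Omega^2$ is the quotient of $\Omega^1\otimes_{k(G)}\Omega^1$ (product denoted $\wedge$) by the relations $\sum v_{a,b}\,\omega_a\wedge\omega_b=0$ if and only if $\sum v_{a,b}\,\omega_a\otimes\omega_b\in\ker(\mathrm{id}-\tilde\Psi)$, where $v_{a,b}\in k(G)$ and $\tilde\Psi$ is the left $k(G)$-linear map with $\tilde\Psi(\omega_a\otimes\omega_b)=\omega_{aba^{-1}}\otimes\omega_a$. With $\theta=\sum_{a\in\mathcal{C}}\omega_a$,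 $\mathrm{d}:\Omega^1\to\Omega^2$ is $\mathrm{d}\omega=\theta\wedge\omega+\omega\wedge\theta$. Then $H^1_{dR}(G)=\{\omega\in\Omega^1:\mathrm{d}\omega=0\}/\mathrm{d}(k(G))$.
   Formalization: The Dynkin diagram is assumed connected and nonempty, since one-dimensionality fails otherwise (for A1×A1 the cohomology has dimension 2); for S_n, spanning by θ is stated for all n, one-dimensionality only for n ≥ 2. *)

(* Defs.v *)
From HB Require Import structures.
From mathcomp Require Import all_boot all_order all_algebra all_fingroup.
From mathcomp Require Import all_character.
Set Implicit Arguments.
Unset Strict Implicit.
Unset Printing Implicit Defensive.
Import GRing.Theory.
Local Open Scope ring_scope.

(* The quotient V / U, carried by a complement of U; the canonical projection
   vpi is the projection along U.  By vpi_eq0 and vpi_surj it is a surjective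
   linear map with kernel U, which determines the quotient up to unique
   isomorphism. *)
Section QuotientSpace.
Variables (k : fieldType) (V : vectType k) (U : {vspace V}).

Definition vquot := subvs_of (U^C)%VS.
HB.instance Definition _ := Vector.on vquot.

Definition vpi (v : V) : vquot := vsproj (U^C)%VS (daddv_pi (U^C)%VS U v).

Lemma vpi_is_linear : linear vpi.
Proof. by move=> c u v; rewrite /vpi !linearP. Qed.
HB.instance Definition _ :=
  GRing.isSemilinear.Build k V vquot *:%R vpi
    (GRing.semilinear_linear vpi_is_linear).

Lemma vpi_eq0 v : (vpi v == 0) = (v \in U).
Proof.
have dir : ((U^C)%VS :&: U = 0)%VS by rewrite capvC capv_compl.
have vE : daddv_pi (U^C)%VS U v + daddv_pi U (U^C)%VS v = v.
  by apply: daddv_pi_add => //; rewrite addvC addv_complf memvf.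
apply/eqP/idP=> [v0 | vU].
  have := congr1 (@vsval _ _ _) v0; rewrite /vpi vsprojK ?memv_pi //= => p0.
  by rewrite -vE p0 add0r memv_pi.
have pU : daddv_pi U (U^C)%VS v = v by rewrite daddv_pi_id // capv_compl.
have -> : vpi v = vsproj (U^C)%VS 0.
  by congr vsproj; apply: (addIr v); rewrite -{2}pU vE add0r.
by rewrite linear0.
Qed.

Lemma vpi_surj (q : vquot) : exists v, vpi v = q.
Proof.
exists (vsval q); rewrite /vpi daddv_pi_id ?vsvalK ?subvsP //.
by rewrite capvC capv_compl.
Qed.

End QuotientSpace.

Section Calculus.
Variables (k : fieldType) (gT : finGroupType) (C : {set gT}).

Definition funG := {ffun gT -> k^o}.
HB.instance Definition _ := Vector.on funG.

Definition Rt (a : gT) (f : funG) : funG := [ffun x => f (x * a)%g].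

(* A free left k(G)-module is represented by the coordinates of its elements;
   lmul is the left action of k(G). *)
Definition freeG (I : finType) := {ffun I -> funG}.
HB.instance Definition _ I := Vector.on (freeG I).

Definition lmul I (f : funG) (w : freeG I) : freeG I :=
  [ffun i => [ffun x => f x * w i x]].

Definition gens := {a : gT | a \in C}.
HB.instance Definition _ := Finite.on gens.

Definition Omega1 := freeG gens.
HB.instance Definition _ := Vector.on Omega1.

(* omega a is the basis vector indexed by a if a \in C, and 0 otherwise. *)
Definition omega (a : gT) : Omega1 := [ffun i => [ffun=> (val i == a)%:R]].

(* (w . f)_a = w_a R_a(f), from omega_a f = R_a(f) omega_a *)
Definition rmul (w : Omega1) (f : funG) : Omega1 :=
  [ffun a => [ffun x => w a x * Rt (val a) f x]].

(* The tensor product over k(G) is the free left k(G)-module with basis the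
   omega_a (x) omega_b; moving coefficients to the left,
   (u (x) v)_(a,b) = u_a R_a(v_b). *)
Definition Omega11 := freeG (gens * gens)%type.
HB.instance Definition _ := Vector.on Omega11.

Definition tens (u v : Omega1) : Omega11 :=
  [ffun p => [ffun x => u p.1 x * Rt (val p.1) (v p.2) x]].

Lemma tens_balanced u f v : tens (rmul u f) v = tens u (lmul f v).
Proof. by apply/ffunP=> p; apply/ffunP=> x; rewrite !ffunE mulrA. Qed.

(* For C stable under conjugation omega (a * b * a^-1) is never junk. *)
Definition Psi (v : Omega11) : Omega11 :=
  \sum_p lmul (v p) (tens (omega (val p.1 * val p.2 * (val p.1)^-1)%g)
                          (omega (val p.1))).

Lemma Psi_is_linear : linear Psi.
Proof.
move=> c u v; rewrite /Psi scaler_sumr -big_split; apply: eq_bigr => p _.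
by apply/ffunP=> q; apply/ffunP=> x; rewrite !ffunE mulrDl -mulrA.
Qed.
HB.instance Definition _ :=
  GRing.isSemilinear.Build k Omega11 Omega11 *:%R Psi
    (GRing.semilinear_linear Psi_is_linear).

Definition relations : {vspace Omega11} := lker (\1 - linfun Psi)%VF.

Definition Omega2 := vquot relations.
HB.instance Definition _ := Vector.on Omega2.

Definition wedge (u v : Omega1) : Omega2 := vpi relations (tens u v).

Definition theta : Omega1 := \sum_(a in C) omega a.

Definition d0 (f : funG) : Omega1 := \sum_(a in C) lmul (Rt a f - f) (omega a).

Definition d1 (w : Omega1) : Omega2 := wedge theta w + wedge w theta.

Lemma d0_is_linear : linear d0.
Proof.
move=> c f g; rewrite /d0 scaler_sumr -big_split; apply: eq_bigr => a _.
apply/ffunP=> i; apply/ffunP=> x; rewrite !ffunE /=.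
by rewrite -[c *: _ in RHS]/(c * _) mulrA -mulrDl mulrBr opprD addrACA.
Qed.
HB.instance Definition _ :=
  GRing.isSemilinear.Build k funG Omega1 *:%R d0
    (GRing.semilinear_linear d0_is_linear).

Lemma d1_is_linear : linear d1.
Proof.
move=> c u v; rewrite /d1 /wedge -!linearD -linearP /=; congr vpi.
apply/ffunP=> p; apply/ffunP=> x; rewrite !ffunE /=.
rewrite -![_ *: _]/(_ * _) !(mulrDl, mulrDr) -!mulrA addrACA.
by rewrite [_ * (c * _)]mulrCA.
Qed.
HB.instance Definition _ :=
  GRing.isSemilinear.Build k Omega1 Omega2 *:%R d1
    (GRing.semilinear_linear d1_is_linear).

Definition closed_forms : {vspace Omega1} := lker (linfun d1).
Definition exact_forms : {vspace Omega1} := limg (linfun d0).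

(* The exact forms, as a subspace of the space of closed forms. *)
Definition exact_in_closed : {vspace subvs_of closed_forms} :=
  (linfun (@vsval _ _ closed_forms) @^-1: exact_forms)%VS.

Definition H1dR := vquot exact_in_closed.
HB.instance Definition _ := Vector.on H1dR.

(* The cohomology class of w; meaningful only for w \in closed_forms. *)
Definition coh_class (w : Omega1) : H1dR :=
  vpi exact_in_closed (vsproj closed_forms w).

(* H^1 = k theta: theta is closed and its class spans H^1. *)
Definition H1_spanned_by_theta : Prop :=
  theta \in closed_forms /\ (<[coh_class theta]> = fullv :> {vspace H1dR})%VS.

End Calculus.

Section RootSystems.
Variables (R : realFieldType) (m : nat).
Implicit Types (u v a b : 'rV[R]_m) (Phi : seq 'rV[R]_m)
  (Delta : m.-tuple 'rV[R]_m).

Definition dot u v : R := (u *m v^T) 0 0.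

Definition cartan b a : R := 2%:R * dot b a / dot a a.

Definition refl a v : 'rV[R]_m := v - cartan v a *: a.

Lemma refl_is_linear a : linear (refl a).
Proof.
move=> c u v; have -> : refl a (c *: u + v) =
    c *: u + v - (c * cartan u a + cartan v a) *: a.
  rewrite /refl /cartan /dot mulmxDl -scalemxAl; congr (_ - _ *: _).
  by rewrite [X in 2%:R * X]mxE [X in X + _]mxE mulrDr mulrDl mulrCA !mulrA.
by rewrite /refl scalerDl opprD addrACA scalerBr scalerA.
Qed.
HB.instance Definition _ a :=
  GRing.isSemilinear.Build R _ _ *:%R (refl a)
    (GRing.semilinear_linear (refl_is_linear a)).

Lemma mul_refl_mx a v : v *m lin1_mx (refl a) = refl a v.
Proof. exact: mul_rV_lin1. Qed.

Record root_system Phi : Prop := RootSystem {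
  root_span : <<Phi>>%VS = fullv;
  root_neq0 : 0 \notin Phi;
  root_reduced : forall a (c : R),
    a \in Phi -> c *: a \in Phi -> c = 1 \/ c = - 1;
  root_refl : forall a b, a \in Phi -> b \in Phi -> refl a b \in Phi;
  root_integral : forall a b, a \in Phi -> b \in Phi ->
    exists z : int, cartan b a = z%:~R
}.

Record root_base Phi Delta : Prop := RootBase {
  base_sub : {subset Delta <= Phi};
  base_basis : basis_of fullv Delta;
  base_sign : forall b, b \in Phi -> exists c : 'I_m -> nat,
    b = \sum_i (c i)%:R *: tnth Delta i \/
    b = - \sum_i (c i)%:R *: tnth Delta i
}.

(* Number of edges joining two distinct nodes of the Dynkin diagram. *)
Definition dynkin_bonds Delta (i j : 'I_m) : R :=
  cartan (tnth Delta i) (tnth Delta j) * cartan (tnth Delta j) (tnth Delta i).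

Definition simply_laced Delta : Prop :=
  forall i j : 'I_m, i != j ->
    dynkin_bonds Delta i j = 0 \/ dynkin_bonds Delta i j = 1.

Definition dynkin_adj Delta : rel 'I_m :=
  [rel i j | (i != j) && (dynkin_bonds Delta i j != 0)].

Definition dynkin_connected Delta : Prop :=
  (0 < m)%N /\ forall i j, connect (dynkin_adj Delta) i j.

Section WeylGroup.
Variables (Phi : seq 'rV[R]_m) (gT : finGroupType).
Variable rW : mx_representation R [set: gT] m.

(* The elements of the group acting as the reflection in some root. *)
Definition reflections : {set gT} :=
  [set g | has (fun a => rW g == lin1_mx (refl a)) Phi].

(* rW identifies gT with the Weyl group of Phi, i.e. with the subgroup of
   GL_m(R) generated by the reflections in the roots. *)
Definition is_weyl_group : Prop :=
  [/\ mx_faithful rW,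
      forall a, a \in Phi -> exists g, rW g = lin1_mx (refl a)
    & <<reflections>>%g = [set: gT]].

End WeylGroup.
End RootSystems.

Definition two_cycles n : {set 'S_n} :=
  [set tperm p.1 p.2 | p : 'I_n * 'I_n & p.1 != p.2].

(* Main.v *)
Require Import Defs.
From HB Require Import structures.
From mathcomp Require Import all_boot all_order all_algebra all_fingroup.
From mathcomp Require Import all_character.
From mathcomp Require Import ring zify.
Set Implicit Arguments.
Unset Strict Implicit.
Unset Printing Implicit Defensive.
Import GRing.Theory.
Local Open Scope ring_scope.

(** Write a 1-form as w = sum_a w_a omega_a and put v_(c,a)(x) = w_a(xc) + w_c(x).
    Since theta has all its coefficients equal to 1, dw = 0 says that v is fixed
    by the braiding, that is
      w_a(xc) + w_c(x) = w_b(xa) + w_a(x),   where b = a^-1 c a,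
    for all a, c in C and x in the group (lemma closed_flat).  Read on the
    Cayley graph of (G, C), with w_a(x) the weight of the edge from x to xa,
    this says that the two paths
      x -> xc -> xca   and   x -> xa -> xab = xca
    have the same total weight.

    Let C consist of involutions.  Adding two of these relations shows that the
    weight w_a(x) + w_a(xa) of the round trip along an edge does not change when
    x is translated by an element of C (sympart_shift) or when a is conjugated by an
    element of C (sympart_conj).  So if C is a single conjugacy class generating
    G, this weight is a constant, which is written 2c because 2 is invertible.
    Subtracting c theta from w makes all round trips weightless.

    What remains is to integrate w: its total weight on a closed path has to
    vanish.  It is enough to treat paths labelled by simple reflections, and
    there the exchange condition applies: in a word of simple reflections with
    product 1 the first letter s, moved along the word and conjugated by each
    letter that it passes, meets a letter equal to what it has become.  Moving s
    does not change the weight, by the relation above (hol_conj); the two equal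
    adjacent letters then form a round trip and can be deleted, so induction on
    the length concludes (hol_loop).
    The exchange condition itself comes from the half-spaces of a Coxeter group:
    the images of a simple root along the word change sign somewhere.

    The class of theta is nonzero: if theta = df then
    f(xa) - f(x) = 1 = f(x) - f(xa), so that 2 = 0.

    For a Weyl group, the half-spaces are given by positivity of the images of
    the simple roots.  Every root is in the orbit of a simple one, and simple
    lacing is what makes all reflections conjugate: two simple roots joined by
    an edge are exchanged, up to a scalar, by the group they generate, and the
    diagram is connected.  For the symmetric group the half-space of the
    transposition (i, i+1) consists of the permutations that keep the order of i
    and i+1, so no root system has to be chosen. *)

(** * Half-spaces and the exchange condition *)

Lemma mem_gen_ind (gT : finGroupType) (A : {set gT}) (P : gT -> Prop) :
  P 1%g -> (forall x a, a \in A -> P x -> P (x * a)%g) ->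
  forall x, x \in <<A>>%g -> P x.
Proof.
move=> P1 PM x /gen_prodgP[n [c cA ->]]; elim: n c cA => [|n IHn] c cA.
  by rewrite big_ord0.
by rewrite big_ord_recr /=; apply: PM => //; apply: IHn => i.
Qed.

(** P i is the set of the g for which the chamber of g lies on the positive side
    of the wall of the simple reflection s i; for a Coxeter group acting on its
    roots, P i g says that g maps the i-th simple root to a positive root.
    hs_wall is the geometric form of the exchange condition: an edge of the
    Cayley graph that crosses the wall of s i is reflected into itself by s i. *)
Record half_spaces (gT : finGroupType) (I : finType) (s : I -> gT)
    (P : I -> pred gT) : Prop := HalfSpaces {
  hs_invol : forall i, (s i * s i = 1)%g;
  hs_gen : <<[set s i | i : I]>>%g = [set: gT];
  hs_one : forall i, P i 1%g;
  hs_flip : forall i g, P i g -> ~~ P i (s i * g)%g;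
  hs_wall : forall i j g, P i g -> ~~ P i (g * s j)%g -> (s i * g = g * s j)%g
}.

(** * Integration of flat weights on the Cayley graph *)
Section Flat.
Variables (k : fieldType) (gT : finGroupType) (C : {set gT}).
Hypothesis C_invol : forall a, a \in C -> (a * a = 1)%g.
Hypothesis C_conj : forall a g, a \in C -> (a ^ g)%g \in C.

(** The weight of the edge from x to x * a is W a x.  Flatness equates the weights
    of the two paths from x to x * c * a = x * a * (c ^ a). *)
Definition flat (W : gT -> gT -> k) : Prop := forall a c x,
  a \in C -> c \in C ->
  W a (x * c)%g + W c x = W (c ^ a)%g (x * a)%g + W a x.

(** The weight of the round trip from x to x * a and back, for a an involution. *)
Definition sympart (W : gT -> gT -> k) a x : k := W a x + W a (x * a)%g.

Lemma conj_invol a b : a \in C -> (b ^ a = a * b * a)%g.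
Proof.
move=> aC; suff aV : (a^-1 = a)%g by rewrite conjgE aV mulgA.
by apply/eqP; rewrite eq_invg_mul C_invol.
Qed.

Lemma mulgKC a x : a \in C -> (x * a * a = x)%g.
Proof. by move=> aC; rewrite -mulgA C_invol ?mulg1. Qed.

Section FlatTheory.
Variable W : gT -> gT -> k.
Hypothesis flatW : flat W.

(** The sum of the flatness relations for (a, b) at x and for (a, b ^ a) at x * a:
    the weights of b and of b ^ a cancel and only those of a remain. *)
Lemma sympart_shift a b x : a \in C -> b \in C ->
  sympart W a (x * b)%g = sympart W a x.
Proof.
move=> aC bC; have := flatW x aC bC.
have := flatW (x * a)%g aC (C_conj a bC).
rewrite -conjgM C_invol // conjg1 conj_invol // !mulgA !mulgKC // => E2 E1.
apply/eqP; rewrite -subr_eq0; apply/eqP; rewrite /sympart.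
move/eqP: E1; rewrite -subr_eq0 => /eqP E1.
move/eqP: E2; rewrite -subr_eq0 => /eqP E2.
by rewrite -(addr0 0) -{1}E1 -E2; ring.
Qed.

(** The sum of the flatness relations for (a, c) at x and at x * c, where
    c = b ^ a: the weights of a cancel, and b = c ^ a appears on the other side. *)
Lemma sympart_conj a b x : a \in C -> b \in C ->
  sympart W (b ^ a)%g x = sympart W b x.
Proof.
move=> aC bC; rewrite -(sympart_shift x bC aC).
have := flatW x aC (C_conj a bC).
have := flatW (x * (b ^ a))%g aC (C_conj a bC).
rewrite -conjgM C_invol // conjg1 mulgKC ?C_conj //.
rewrite conj_invol // !mulgA !mulgKC // => E2 E1.
apply/eqP; rewrite -subr_eq0; apply/eqP; rewrite /sympart !mulgA.
move/eqP: E1; rewrite -subr_eq0 => /eqP E1.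
move/eqP: E2; rewrite -subr_eq0 => /eqP E2.
by rewrite -(addr0 0) -{1}E1 -E2; ring.
Qed.

Section Holonomy.
Variables (I : finType) (s : I -> gT) (P : I -> pred gT).
Hypothesis hsP : half_spaces s P.
Hypothesis sC : forall i, s i \in C.

(** Words u in the simple reflections are paths of the Cayley graph: eval u is the
    displacement along the path, and hol x u its weight when it starts at x. *)
Definition eval (u : seq I) : gT := (\prod_(i <- u) s i)%g.

Fixpoint hol (x : gT) (u : seq I) : k :=
  if u is i :: u' then W (s i) x + hol (x * s i)%g u' else 0.

Lemma eval_cons i u : eval (i :: u) = (s i * eval u)%g.
Proof. exact: big_cons. Qed.

Lemma eval_cat u v : eval (u ++ v) = (eval u * eval v)%g.
Proof. exact: big_cat. Qed.

Lemma eval_surj g : exists u, eval u == g.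
Proof.
have : g \in <<[set s i | i : I]>>%g by rewrite (hs_gen hsP) inE.
elim/mem_gen_ind: g / => [|x _ /imsetP[i _ ->] [u /eqP <-]].
  by exists [::]; rewrite /eval big_nil.
by exists (rcons u i); rewrite -cats1 eval_cat /eval big_seq1.
Qed.

Lemma hol_cat x u v : hol x (u ++ v) = hol x u + hol (x * eval u)%g v.
Proof.
elim: u x => [|i u IHu] x; first by rewrite /eval big_nil mulg1 add0r.
by rewrite /= IHu eval_cons mulgA addrA.
Qed.

(** Each step of the path turns c into a conjugate, across one flatness square, so
    an edge labelled c can be slid along the whole path at no cost. *)
Lemma hol_conj c x u : c \in C ->
  W c x + hol (x * c)%g u = hol x u + W (c ^ eval u)%g (x * eval u)%g.
Proof.
elim: u c x => [|i u IHu] c x cC /=.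
  by rewrite /eval big_nil conjg1 mulg1 addrC.
rewrite eval_cons mulgA conjgM addrA [W c x + _]addrC flatW //.
have := IHu (c ^ s i)%g (x * s i)%g (C_conj _ cC).
have -> : (x * s i * (c ^ s i) = x * c * s i)%g.
  by rewrite conj_invol // !mulgA mulgKC.
by move=> E; rewrite addrAC E addrC addrA.
Qed.

Lemma crossing (Q : pred gT) g u : Q g -> ~~ Q (g * eval u)%g ->
  exists u1 j u2, [/\ u = u1 ++ j :: u2, Q (g * eval u1)%g
    & ~~ Q (g * eval u1 * s j)%g].
Proof.
elim: u g => [|i u IHu] g Qg; first by rewrite /eval big_nil mulg1 Qg.
rewrite eval_cons mulgA => nQ; have [Qgi | nQgi] := boolP (Q (g * s i)%g).
  have [u1 [j [u2 [-> Qu1 nQu1]]]] := IHu _ Qgi nQ.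
  by exists (i :: u1), j, u2; rewrite eval_cons mulgA.
by exists [::], i, u; rewrite /eval big_nil mulg1.
Qed.

Hypothesis symW : forall a x, a \in C -> sympart W a x = 0.

(** The first letter i of a word of product 1 leaves the half-space P i, which the
    remaining word u must leave as well, by a letter j that is conjugate to i
    through the part v1 of u before it.  Sliding i along v1 makes the two
    letters adjacent; they cancel and leave a shorter word of product 1. *)
Lemma hol_loop x u : eval u = 1%g -> hol x u = 0.
Proof.
have [n] := ubnP (size u); elim: n u x => // n IHn [|i u] x //=.
rewrite ltnS eval_cons => size_u u1.
have evu : eval u = (s i * 1)%g.
  by rewrite -u1 mulgA (hs_invol hsP) mul1g.
(* u evaluates to s i, outside P i, and starts from 1, inside P i *)
have [||v1 [j [v2 [def_u Pi nPi]]]] := @crossing (P i) 1%g u.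
- exact: hs_one hsP i.
- by rewrite mul1g evu (hs_flip hsP) // (hs_one hsP).
rewrite !mul1g in Pi nPi; have sij := hs_wall hsP Pi nPi.
have sj : (s i ^ eval v1 = s j)%g by rewrite conjgE sij mulKg.
rewrite def_u hol_cat addrA hol_conj //= sj -mulgA sij mulgA mulgKC //.
rewrite -addrA [W (s j) _ + (_ + _)]addrA -[X in _ + (X + _)]/(sympart W _ _).
rewrite symW // add0r -hol_cat.
apply: IHn; first by move: size_u; rewrite def_u !size_cat /= addnS => /ltnW.
by rewrite -[RHS]u1 def_u !eval_cat eval_cons !mulgA sij mulgKC.
Qed.

Lemma hol_path x u v : eval u = eval v -> hol x u = hol x v.
Proof.
move=> uv; have [r /eqP er] := eval_surj (eval u)^-1%g.
(* r closes both paths, into loops of weight 0 *)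
apply: (addIr (hol (x * eval u)%g r)).
by rewrite {2}uv -!hol_cat !hol_loop // eval_cat er -?uv mulgV.
Qed.

(** The potential at g is the weight of any path of simple reflections from 1 to g.
    This integrates W along simple edges; a flatness square with two sides s j
    passes from the edges labelled c to those labelled c ^ s j, and so reaches all
    conjugates of simple reflections. *)
Lemma flat_potential : (forall c, c \in C -> exists i g, c = (s i ^ g)%g) ->
  exists f : gT -> k, forall c x, c \in C -> W c x = f (x * c)%g - f x.
Proof.
move=> Cs; pose word g := xchoose (eval_surj g).
have wordP g : eval (word g) = g by apply/eqP/(xchooseP (eval_surj g)).
pose f g := hol 1%g (word g).
have fs i x : W (s i) x = f (x * s i)%g - f x.
  rewrite (_ : f (x * s i)%g = hol 1%g (word x ++ [:: i])).
    by rewrite hol_cat /= wordP mul1g /f; ring.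
  by apply: hol_path; rewrite eval_cat !wordP /eval big_seq1.
exists f => c x cC.
have [i [g def_c]] := Cs c cC; have : g \in [set: gT] by rewrite inE.
rewrite {}def_c {c cC} -(hs_gen hsP) => gS.
elim/mem_gen_ind: g / gS x => [|g _ /imsetP[j _ ->] IHg] x.
  by rewrite conjg1 fs.
rewrite conjgM; have cC : (s i ^ g)%g \in C by apply: C_conj.
move: (s i ^ g)%g cC IHg => c cC IHc.
have := flatW (x * s j)%g (sC j) cC.
rewrite mulgKC // IHc !fs mulgKC // conj_invol // !mulgA.
move=> /eqP; rewrite -subr_eq0 => /eqP E.
by apply/eqP; rewrite -subr_eq0 -oppr_eq0; apply/eqP; rewrite -[RHS]E; ring.
Qed.

End Holonomy.
End FlatTheory.
End Flat.


(** * Closed and exact 1-forms *)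
Section Forms.
Variables (k : fieldType) (gT : finGroupType) (C : {set gT}).
Hypothesis C_conj : forall a g, a \in C -> (a ^ g)%g \in C.

(** The coordinates of a 1-form, indexed by the group rather than by the subtype
    of its generators, so that conjugates of indices need no membership proofs. *)
Definition coef (w : Omega1 k C) (a x : gT) : k :=
  oapp (fun i : gens C => w i x) 0 (insub a).

Lemma coefE (w : Omega1 k C) (i : gens C) x : coef w (val i) x = w i x.
Proof. by rewrite /coef valK. Qed.

Lemma eq_coef (w w' : Omega1 k C) :
  (forall a x, a \in C -> coef w a x = coef w' a x) -> w = w'.
Proof.
move=> eqw; apply/ffunP=> i; apply/ffunP=> x.
by rewrite -!coefE eqw // (valP i).
Qed.

Lemma sum_omegaE (F : gT -> funG k gT) (i : gens C) x :
  (\sum_(a in C) lmul (F a) (omega k C a)) i x = F (val i) x.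
Proof.
rewrite sum_ffunE sum_ffunE (bigD1 (val i)) ?(valP i) //= big1 => [|a].
  by rewrite !ffunE eqxx mulr1 addr0.
by case/andP=> _ ne_ai; rewrite !ffunE eq_sym (negPf ne_ai) mulr0.
Qed.

Lemma coef_theta a x : a \in C -> coef (theta k C) a x = 1.
Proof.
move=> aC; rewrite (coefE _ (Sub a aC : gens C)).
rewrite (_ : theta k C = \sum_(a in C) lmul [ffun=> 1] (omega k C a)).
  by rewrite sum_omegaE ffunE.
apply: eq_bigr => b _; apply/ffunP=> i; apply/ffunP=> y.
by rewrite !ffunE mul1r.
Qed.

Lemma coef_d0 f a x : a \in C -> coef (d0 C f) a x = f (x * a)%g - f x.
Proof.
by move=> aC; rewrite (coefE _ (Sub a aC : gens C)) sum_omegaE !ffunE.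
Qed.

Lemma coefD w w' a x : coef (w + w') a x = coef w a x + coef w' a x.
Proof. by rewrite /coef; case: insub => [i|] /=; rewrite ?addr0 ?ffunE. Qed.

Lemma coefZ c w a x : coef (c *: w) a x = c * coef w a x.
Proof. by rewrite /coef; case: insub => [i|] /=; rewrite ?mulr0 ?ffunE. Qed.

Definition conj_gen (a c : gens C) : gens C :=
  Sub (val c ^ val a)%g (C_conj (val a) (valP c)).

Lemma PsiE (v : Omega11 k C) c a x : Psi v (c, a) x = v (a, conj_gen a c) x.
Proof.
rewrite /Psi sum_ffunE sum_ffunE (bigD1 (a, conj_gen a c)) //= big1 => [|[b d]].
  by rewrite !ffunE /= conjgE mulKVg mulgK !eqxx !mulr1 addr0.
rewrite xpair_eqE => ne; rewrite !ffunE /=.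
have [ab|] := eqVneq (val a) (val b); last by rewrite mulr0 mulr0.
rewrite mulr1; case: eqP => [cE|]; last by rewrite mulr0.
case/negP: ne; rewrite -!val_eqE /= ab eqxx cE conjgE.
by rewrite -!mulgA mulVg mulg1 mulKg eqxx.
Qed.

(** The tensor theta (x) w + w (x) theta has coordinate w_b(x a) + w_a(x) at (a, b),
    and dw = 0 says that it is fixed by Psi, that is, that its coordinates at
    (c, a) and (a, c ^ a) agree. *)
Lemma closed_flat (w : Omega1 k C) :
  w \in closed_forms k C <-> flat C (coef w).
Proof.
rewrite memv_ker lfunE /= /d1 /wedge -linearD vpi_eq0 memv_ker.
do 3!rewrite !lfunE /=; rewrite subr_eq0.
set v : Omega11 k C := _ + _.
have vE (a b : gens C) x :
    v (a, b) x = coef w (val b) (x * val a)%g + coef w (val a) x.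
  rewrite !coefE !ffunE /= -!(coefE (theta k C)) !coef_theta ?(valP a) ?(valP b) //.
  by rewrite mul1r mulr1.
split=> [/eqP fixv a c x aC cC | flatw].
  have := congr1 (fun v' : Omega11 k C => v' (Sub c cC, Sub a aC) x) fixv.
  by rewrite PsiE !vE.
apply/eqP/ffunP=> -[c a]; apply/ffunP=> x.
by rewrite PsiE !vE /= flatw // ?(valP a) ?(valP c).
Qed.

Lemma theta_closed : theta k C \in closed_forms k C.
Proof.
by apply/closed_flat=> a c x aC cC; rewrite !coef_theta ?C_conj.
Qed.

Lemma coh_class_spanned :
  (forall w, w \in closed_forms k C -> exists c f,
      w = c *: theta k C + d0 C f) ->
  H1_spanned_by_theta k C.
Proof.
move=> span; split; first exact: theta_closed.
apply/eqP; rewrite eqEsubv subvf; apply/subvP=> q _.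
have [v <-] := vpi_surj q; have [c [f vE]] := span _ (subvsP v).
apply/vlineP; exists c; apply/eqP.
rewrite /coh_class -subr_eq0 -linearZ -linearB vpi_eq0 -memv_preim lfunE /=.
rewrite vsprojK ?theta_closed // vE addrC addKr.
by rewrite -[d0 C f](lfunE (d0 C)) memv_img ?memvf.
Qed.

(** A potential of theta would increase by 1 along each edge, in both directions. *)
Lemma theta_not_exact : 2%N \notin [pchar k] ->
  forall a, a \in C -> (a * a = 1)%g -> theta k C \notin exact_forms k C.
Proof.
move=> char_k a aC aa; apply/memv_imgP=> -[f _]; rewrite lfunE /= => th.
have fE x : f (x * a)%g - f x = 1 by rewrite -coef_d0 // -th coef_theta.
have := fE a; rewrite aa => fa; have := fE 1%g; rewrite mul1g => f1.
case/negP: char_k; rewrite inE /=; apply/eqP.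
by rewrite (_ : 2%:R = 1 + 1) // -{1}fa -f1; ring.
Qed.

Lemma dim_H1 : H1_spanned_by_theta k C ->
  theta k C \notin exact_forms k C -> \dim {: H1dR k C} = 1%N.
Proof.
case=> _ <- nexact; rewrite dim_vline /coh_class vpi_eq0 -memv_preim lfunE /=.
by rewrite vsprojK ?theta_closed // nexact.
Qed.

End Forms.

(** The hypotheses describe a finite Coxeter group whose reflections C form one
    conjugacy class.  That class carries a single value c of the round trip
    weights, so that w - (c / 2) theta has none and is exact. *)
Theorem H1_half_spaces (k : fieldType) (gT : finGroupType) (C : {set gT})
    (I : finType) (s : I -> gT) (P : I -> pred gT) :
    2%N \notin [pchar k] -> half_spaces s P ->
    (forall i j, exists g, (s i ^ g = s j)%g) ->
    (forall c, c \in C <-> exists i g, c = (s i ^ g)%g) ->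
  H1_spanned_by_theta k C /\
    ((exists a, a \in C) -> \dim {: H1dR k C} = 1%N).
Proof.
move=> char_k hsP one_class CE.
have two_neq0 : 2%:R != 0 :> k by move: char_k; rewrite inE.
have sC i : s i \in C by apply/CE; exists i, 1%g; rewrite conjg1.
have C_conj a g : a \in C -> (a ^ g)%g \in C.
  by case/CE=> i [h ->]; apply/CE; exists i, (h * g)%g; rewrite conjgM.
have C_invol a : a \in C -> (a * a = 1)%g.
  by case/CE=> i [g ->]; rewrite -conjMg (hs_invol hsP) conj1g.
suff span w : w \in closed_forms k C ->
    exists c f, w = c *: theta k C + d0 C f.
  have H1th : H1_spanned_by_theta k C by apply: coh_class_spanned.
  split=> // -[a aC]; apply: dim_H1 => //.
  by apply: theta_not_exact aC (C_invol a aC).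
move/(closed_flat C_conj)=> flatw.
have symE : exists c, forall a x, a \in C -> sympart (coef w) a x = c.
  have [i0 _|I0] := pickP I; last first.
    by exists 0 => a x /CE[i]; have := I0 i.
  exists (sympart (coef w) (s i0) 1%g) => a x /CE[i [g ->]].
  have [h <-] := one_class i0 i; rewrite -conjgM.
  move: (h * g)%g => {i h}g; have : g \in <<[set s i | i : I]>>%g.
    by rewrite (hs_gen hsP) inE.
  elim/mem_gen_ind: g / => [|g _ /imsetP[j _ ->] <-]; last first.
    by rewrite conjgM (sympart_conj C_invol C_conj) // C_conj.
  rewrite conjg1; have : x \in <<[set s i | i : I]>>%g.
    by rewrite (hs_gen hsP) inE.
  elim/mem_gen_ind: x / => [|x _ /imsetP[j _ ->] <-] //.
  by rewrite (sympart_shift C_invol C_conj).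
have [c symc] := symE; pose W a x := coef w a x - c / 2%:R.
have flatW : flat C W.
  move=> a b x aC bC; have := flatw a b x aC bC => E.
  by rewrite /W addrACA E addrACA.
have symW a x : a \in C -> sympart W a x = 0.
  move=> aC; rewrite /sympart /W addrACA.
  by rewrite -[coef w a x + _]/(sympart _ _ _) symc //; field.
have [c0|f fE] := flat_potential C_invol C_conj flatW hsP sC symW.
  by move/CE.
exists (c / 2%:R), [ffun x => f x : k^o]; apply: eq_coef => a x aC.
rewrite coefD coefZ coef_theta // coef_d0 // !ffunE -fE // mulr1 /W.
by rewrite addrC subrK.
Qed.


(** * The symmetric group *)
Section SymmetricGroup.
Variable n : nat.

Definition adjacent := {p : 'I_n * 'I_n | p.2 == p.1.+1 :> nat}.

Definition adj_tperm (p : adjacent) : 'S_n := tperm (val p).1 (val p).2.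

(** The half-space of (i, i+1): positivity of the image of the root e_(i+1) - e_i. *)
Definition adj_order (p : adjacent) (g : 'S_n) : bool :=
  (g (val p).1 < g (val p).2)%N.

Lemma adj_neq (p : adjacent) : (val p).1 != (val p).2.
Proof. by rewrite -val_eqE /= (eqP (valP p)) neq_ltn ltnSn. Qed.

(** By induction on j - i: the transposition (i, j) is the conjugate of (i, j-1) by
    the adjacent transposition (j-1, j). *)
Lemma tperm_gen (i j : 'I_n) : tperm i j \in <<[set adj_tperm p | p : adjacent]>>%g.
Proof.
wlog: i j / (i <= j)%N => [IH | le_ij].
  by have [/IH|/ltnW/IH] := leqP i j => //; rewrite tpermC.
have [d] := ubnP (j - i)%N; elim: d j le_ij => // d IHd j le_ij lt_d.
have [->|ne_ij] := eqVneq i j; first by rewrite tperm1 group1.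
have lt_ij : (i < j)%N by rewrite ltn_neqAle ne_ij.
have j1_lt : (j.-1 < n)%N by apply: leq_ltn_trans (leq_pred j) (ltn_ord j).
pose j1 := Ordinal j1_lt; have j_gt0 : (0 < j)%N by apply: leq_trans lt_ij.
have adjP : j == j1.+1 :> nat by rewrite /= prednK.
have jS : tperm j1 j \in <<[set adj_tperm p | p : adjacent]>>%g.
  by apply/mem_gen/imsetP; exists (Sub (j1, j) adjP : adjacent).
have [ij1|ne_ij1] := eqVneq i j1; first by rewrite ij1.
have -> : tperm i j = (tperm i j1 ^ tperm j1 j)%g.
  rewrite tpermJ tpermL tpermD // eq_sym //.
rewrite groupJ // IHd //=; first by rewrite -ltnS prednK.
by move: lt_d; rewrite -{1}(prednK j_gt0) subSn // -ltnS prednK.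
Qed.

Lemma adj_half_spaces : half_spaces adj_tperm adj_order.
Proof.
split=> [p||p|p g|p q g]; rewrite /adj_order.
- exact: tperm2.
- apply/eqP; rewrite eqEsubset subsetT; apply/subsetP=> g _.
  by have [ts -> _] := prod_tpermP g; apply: group_prod => t _; apply: tperm_gen.
- by rewrite !perm1 (eqP (valP p)).
- by rewrite !permM tpermL tpermR -leqNgt; apply: ltnW.
move=> gp; rewrite !permM -leqNgt => gtp.
(* g maps the pair of p to a pair in increasing order, which the adjacent
   transposition of q puts out of order: it has to be the pair of q *)
suff [g1 g2] : g (val p).1 = (val q).1 /\ g (val p).2 = (val q).2.
  by rewrite /adj_tperm -g1 -g2 -tpermJ conjgE mulKVg.
have ne_g : g (val p).1 != g (val p).2 by rewrite (inj_eq perm_inj) adj_neq.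
move: gtp; rewrite /adj_tperm; case: q => -[a b] /= /eqP /= ab.
move: (g (val p).1) (g (val p).2) gp ne_g => x y lt_xy ne_xy le_t.
suff [xa yb] : x = a :> nat /\ y = b :> nat by split; apply: val_inj.
have tE (z : 'I_n) : tperm a b z = (if z == a :> nat then b
    else if z == b :> nat then a else z) :> nat.
  by rewrite !val_eqE; case: tpermP => [->|->|/eqP/negPf-> /eqP/negPf->];
    rewrite ?eqxx //; case: eqP => [->|].
by move: le_t ne_xy; rewrite !tE -val_eqE /=; do ?[case: eqP => ?] => //; lia.
Qed.

Lemma tperm_class (i j i' j' : 'I_n) : i != j -> i' != j' ->
  exists g, (tperm i j ^ g)%g = tperm i' j'.
Proof.
move=> ne ne'; exists (tperm i i' * tperm (tperm i i' j) j')%g.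
rewrite conjgM !tpermJ tpermL tpermL.
congr tperm; apply: tpermD; last by rewrite eq_sym.
by rewrite -{2}(tpermL i i') (inj_eq perm_inj) eq_sym.
Qed.

Lemma H1_symmetric (k : fieldType) : 2%N \notin [pchar k] ->
  H1_spanned_by_theta k (two_cycles n) /\
  ((2 <= n)%N -> \dim {: H1dR k (two_cycles n)} = 1%N).
Proof.
move=> char_k.
have one_class p q : exists g, (adj_tperm p ^ g)%g = adj_tperm q.
  exact: tperm_class (adj_neq p) (adj_neq q).
have CE c : c \in two_cycles n <-> exists p g, c = (adj_tperm p ^ g)%g.
  split=> [/imsetP[[i j]] | [p [g ->]]]; rewrite ?inE /=.
    move=> ne_ij ->; have [p] : inhabited adjacent.
      wlog lt_ij : i j {ne_ij} / (i < j)%N => [IH|].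
        by move: ne_ij; rewrite -val_eqE neq_ltn => /orP[/IH|/IH].
      have j1_lt : (j.-1 < n)%N by apply: leq_ltn_trans (leq_pred j) (ltn_ord j).
      have adjP : j == (Ordinal j1_lt).+1 :> nat.
        by rewrite /= prednK // (leq_trans _ lt_ij).
      by exists; exists (Ordinal j1_lt, j).
    by have [g <-] := tperm_class (adj_neq p) ne_ij; exists p, g.
  rewrite /adj_tperm tpermJ; apply/imsetP; exists (g (val p).1, g (val p).2) => //.
  by rewrite inE /= (inj_eq perm_inj) adj_neq.
have [spanned dim1] := H1_half_spaces char_k adj_half_spaces one_class CE.
split=> // n_gt1; apply: dim1; exists (tperm (Ordinal (ltnW n_gt1)) (Ordinal n_gt1)).
by apply/imsetP; exists (Ordinal (ltnW n_gt1), Ordinal n_gt1); rewrite ?inE.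
Qed.

End SymmetricGroup.


(** * Reflections in Euclidean space *)

Import Order.TTheory Num.Theory.

Section Reflections.
Variables (R : realFieldType) (m : nat).
Implicit Types u v a : 'rV[R]_m.

Lemma dotC u v : dot u v = dot v u.
Proof. by rewrite /dot -[v *m _]trmxK trmx_mul trmxK [in RHS]mxE. Qed.

Lemma dotDl u w v : dot (u + w) v = dot u v + dot w v.
Proof. by rewrite /dot mulmxDl mxE. Qed.

Lemma dotZl c u v : dot (c *: u) v = c * dot u v.
Proof. by rewrite /dot -scalemxAl mxE. Qed.

Lemma dotBl u w v : dot (u - w) v = dot u v - dot w v.
Proof. by rewrite dotDl -scaleN1r dotZl mulN1r. Qed.

Lemma dot_gt0 v : v != 0 -> 0 < dot v v.
Proof.
move=> v0; have dotE : dot v v = \sum_i v 0 i ^+ 2.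
  by rewrite /dot mxE; apply: eq_bigr => i _; rewrite mxE expr2.
rewrite lt_def dotE sumr_ge0 ?andbT => [|i _]; last exact: sqr_ge0.
apply: contraNneq v0 => /eqP; rewrite psumr_eq0 => [/allP v_i0|i _].
  apply/eqP/rowP=> i; rewrite mxE; apply/eqP.
  by rewrite -sqrf_eq0; apply: v_i0 (mem_index_enum i).
exact: sqr_ge0.
Qed.

Lemma dot_refl a u v : a != 0 -> dot (refl a u) (refl a v) = dot u v.
Proof.
move/dot_gt0/lt0r_neq0=> aa; rewrite /refl dotBl dotZl ![dot _ (_ - _)]dotC.
by rewrite !dotBl !dotZl /cartan [dot a u]dotC [dot v u]dotC; field.
Qed.

Lemma refl_root a : a != 0 -> refl a a = - a.
Proof.
move/dot_gt0/lt0r_neq0=> aa; rewrite /refl /cartan mulfK //.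
by rewrite scaler_nat mulr2n opprD addrA subrr add0r.
Qed.

Lemma refl_involutive a : a != 0 -> involutive (refl a).
Proof.
move=> a0 v; rewrite {1}[refl a v]/refl linearB linearZ /= refl_root //.
by rewrite scalerN opprK /refl subrK.
Qed.

Lemma refl_scale a c v : c != 0 -> refl (c *: a) v = refl a v.
Proof.
move=> c0; rewrite /refl /cartan; congr (_ - _); rewrite scalerA; congr (_ *: _).
rewrite ![dot _ (c *: a)]dotC !dotZl [dot a v]dotC [dot a (c *: a)]dotC dotZl.
have [->|aa] := eqVneq (dot a a) 0; first by rewrite !mulr0 invr0 !mulr0 mul0r.
by field; rewrite c0 aa.
Qed.

End Reflections.

(** * Weyl groups *)
Section Weyl.
Variables (R : realFieldType) (m : nat) (Phi : seq 'rV[R]_m).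
Variables (Delta : m.-tuple 'rV[R]_m) (W : finGroupType).
Variable rW : mx_representation R [set: W] m.
Hypothesis rsP : root_system Phi.
Hypothesis rbP : root_base Phi Delta.
Hypothesis wgP : is_weyl_group Phi rW.

Lemma root_nz a : a \in Phi -> a != 0.
Proof. by apply: contraTneq => ->; exact: root_neq0 rsP. Qed.

Lemma repM g h : rW (g * h)%g = rW g *m rW h.
Proof. by rewrite repr_mxM ?inE. Qed.

Lemma rep_inj g h : rW g = rW h -> g = h.
Proof.
by case: wgP => faith _ _; move/(mx_faithful_inj faith); apply; rewrite inE.
Qed.

Lemma weyl_ind (P : W -> Prop) : P 1%g ->
  (forall g r a, a \in Phi -> rW r = lin1_mx (refl a) -> P g -> P (g * r)%g) ->
  forall g, P g.
Proof.
case: wgP => _ _ gen P1 PM g; have : g \in <<reflections Phi rW>>%g.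
  by rewrite gen inE.
elim/mem_gen_ind: g / => // g r; rewrite inE => /hasP[a aP /eqP rE].
exact: PM rE.
Qed.

Lemma dot_act g u v : dot (u *m rW g) (v *m rW g) = dot u v.
Proof.
elim/weyl_ind: g u v => [|g r a aP rE IHg] u v; first by rewrite repr_mx1 !mulmx1.
by rewrite repM !mulmxA rE !mul_refl_mx dot_refl ?root_nz.
Qed.

Lemma root_act g a : a \in Phi -> a *m rW g \in Phi.
Proof.
elim/weyl_ind: g a => [|g r b bP rE IHg] a aP; first by rewrite repr_mx1 mulmx1.
by rewrite repM mulmxA rE mul_refl_mx (root_refl rsP) ?IHg.
Qed.

(** Because the group acts by isometries, conjugating the reflection in a by g gives
    the reflection in the image of a. *)
Lemma rep_refl_conj r a g : rW r = lin1_mx (refl a) ->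
  rW (r ^ g)%g = lin1_mx (refl (a *m rW g)).
Proof.
move=> rE; apply/row_matrixP=> i; rewrite !rowE.
set v : 'rV_m := delta_mx _ _; rewrite mul_refl_mx conjgE !repM rE !mulmxA.
rewrite mul_refl_mx /refl mulmxBl -scalemxAl.
have vgK : v *m rW g^-1%g *m rW g = v by rewrite repr_mxKV ?inE.
by rewrite /cartan -(dot_act g _ a) -(dot_act g a a) vgK.
Qed.

Definition positive v := [forall j, 0 <= coord Delta j v].

Lemma simpleE i : tnth Delta i = Delta`_i.
Proof. exact: tnth_nth. Qed.

Lemma base_free : free Delta.
Proof. exact: basis_free (base_basis rbP). Qed.

Lemma coord_simple i j : coord Delta j (tnth Delta i) = (i == j)%:R.
Proof. by rewrite simpleE coord_free ?base_free // eq_sym. Qed.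

Lemma sum_coord v : v = \sum_i coord Delta i v *: tnth Delta i.
Proof.
rewrite {1}(coord_basis (base_basis rbP) (memvf v)).
by apply: eq_bigr => i _; rewrite simpleE.
Qed.

Lemma simple_root i : tnth Delta i \in Phi.
Proof. exact: (base_sub rbP) (mem_tnth i Delta). Qed.

Lemma coord_comb (c : 'I_m -> R) j :
  coord Delta j (\sum_i c i *: tnth Delta i) = c j.
Proof.
under eq_bigr do rewrite simpleE.
by rewrite coord_sum_free ?base_free.
Qed.

Lemma root_sign b : b \in Phi -> positive b \/ positive (- b).
Proof.
case/(base_sign rbP)=> c [->|->]; [left | right]; apply/forallP=> j;
  by rewrite ?opprK coord_comb ler0n.
Qed.

Lemma positiveN b : b \in Phi -> positive b -> ~~ positive (- b).
Proof.
move=> bP /forallP pos; apply/forallP=> neg; case/negP: (root_nz bP).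
rewrite (sum_coord b) big1 // => i _; have := pos i; have := neg i.
rewrite linearN /= oppr_ge0 => le ge.
by rewrite (_ : coord Delta i b = 0) ?scale0r //; apply/le_anti/andP.
Qed.

Lemma positive_simple i : positive (tnth Delta i).
Proof. by apply/forallP=> j; rewrite coord_simple ler0n. Qed.

(** The reflection in Delta j changes only the j-th coordinate of b.  If it makes the
    positive root b negative, the other coordinates are 0, so b is a multiple of
    Delta j. *)
Lemma simple_refl_positive j b : b \in Phi -> positive b ->
  ~~ positive (refl (tnth Delta j) b) -> b = tnth Delta j.
Proof.
move=> bP pos npos; have b'P := root_refl rsP (simple_root j) bP.
have neg : positive (- refl (tnth Delta j) b).
  by case: (root_sign b'P) => // pos'; rewrite pos' in npos.
have bE : b = coord Delta j b *: tnth Delta j.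
  rewrite {1}(sum_coord b) (bigD1 j) //= big1 ?addr0 // => i ne_ij.
  rewrite (_ : coord Delta i b = 0) ?scale0r //; apply/le_anti.
  rewrite (forallP pos i) andbT; have := forallP neg i.
  rewrite /refl linearN linearB linearZ /= coord_simple eq_sym (negPf ne_ij).
  by rewrite mulr0 subr0 oppr_ge0.
have := bP; rewrite bE => /(root_reduced rsP (simple_root j)) [->|cN1].
  by rewrite scale1r.
by have := forallP pos j; rewrite cN1 lerNr oppr0 ler10.
Qed.

Definition height b := \sum_i coord Delta i b.

Lemma height_bound b : b \in Phi -> exists n, height b < n%:R.
Proof.
case/(base_sign rbP)=> c bE; exists (\sum_i c i).+1; rewrite /height.
apply: (@le_lt_trans _ _ (\sum_i (c i)%:R)); last by rewrite -natr_sum ltr_nat.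
apply: ler_sum => i _; case: bE => ->; rewrite ?linearN /= coord_comb //.
by rewrite (@le_trans _ _ 0) // ?oppr_le0 ler0n.
Qed.

(** Otherwise dot b b, a combination of the dot b (Delta i) with nonnegative
    coefficients, could not be positive. *)
Lemma acute_simple b : b \in Phi -> positive b ->
  exists j, 0 < dot b (tnth Delta j).
Proof.
move=> bP pos; apply/existsP; apply: contraT; rewrite negb_exists => /forallP obt.
have := dot_gt0 (root_nz bP); rewrite ltNge; case/negP.
suff -> : dot b b = \sum_i coord Delta i b * dot b (tnth Delta i).
  apply: sumr_le0 => i _; apply: mulr_ge0_le0; first exact: (forallP pos).
  by rewrite leNgt obt.
rewrite {1}(sum_coord b) /dot mulmx_suml summxE.
by apply: eq_bigr => i _; rewrite -[LHS]/(dot _ _) dotZl [dot _ b]dotC.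
Qed.

Section SimpleReflections.
Variable s : 'I_m -> W.
Hypothesis sE : forall i, rW (s i) = lin1_mx (refl (tnth Delta i)).

Lemma simple_invol i : (s i * s i = 1)%g.
Proof.
apply: rep_inj; rewrite repM repr_mx1; apply/row_matrixP=> j.
rewrite !rowE mulmxA mulmx1 sE !mul_refl_mx refl_involutive //.
exact/root_nz/simple_root.
Qed.

Lemma act_simple (v : 'rV_m) i : v *m rW (s i) = refl (tnth Delta i) v.
Proof. by rewrite sE mul_refl_mx. Qed.

Lemma act_simpleK (v : 'rV_m) i : v *m rW (s i) *m rW (s i) = v.
Proof. by rewrite -mulmxA -repM simple_invol repr_mx1 mulmx1. Qed.

(** Induction on the height: a positive root b makes an acute angle with some
    Delta j, and unless b is Delta j the reflection in Delta j gives a positive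
    root whose height is smaller by the positive integer cartan b (Delta j). *)
Lemma root_orbit b : b \in Phi ->
  exists i g, g \in <<[set s i | i : 'I_m]>>%g /\ b = tnth Delta i *m rW g.
Proof.
have sS i : s i \in <<[set s i | i : 'I_m]>>%g by apply/mem_gen/imset_f.
have pos_orbit : forall n b, b \in Phi -> positive b -> height b < n%:R ->
    exists i g, g \in <<[set s i | i : 'I_m]>>%g /\ b = tnth Delta i *m rW g.
  elim=> [|n IHn] {}b bP pos lt_n.
    by move: lt_n; rewrite ltNge sumr_ge0 // => i _; apply: (forallP pos).
  have [j bj] := acute_simple bP pos.
  have [pos'|npos] := boolP (positive (refl (tnth Delta j) b)); last first.
    exists j, 1%g; rewrite group1 repr_mx1 mulmx1; split=> //.
    exact: simple_refl_positive npos.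
  have [|i [g [gS gE]]] := IHn _ (root_refl rsP (simple_root j) bP) pos'.
    have c_ge1 : 1 <= cartan b (tnth Delta j).
      have [z zE] := root_integral rsP (simple_root j) bP.
      have : 0 < cartan b (tnth Delta j).
        by rewrite divr_gt0 ?mulr_gt0 ?ltr0n // dot_gt0 ?root_nz ?simple_root.
      by rewrite zE ltr0z ler1z gtz0_ge1.
    have -> : height (refl (tnth Delta j) b) = height b - cartan b (tnth Delta j).
      rewrite /height /refl; under eq_bigr do rewrite linearB linearZ /= coord_simple.
      rewrite sumrB; congr (_ - _); rewrite (bigD1 j) //= big1 ?eqxx => [|i].
        by rewrite mulr1 addr0.
      by rewrite eq_sym => /negPf->; rewrite mulr0.
    rewrite ltrBlDr (lt_le_trans lt_n) // -natr1 lerD2l //.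
  exists i, (g * s j)%g; rewrite groupM // repM mulmxA -gE.
  by rewrite -act_simple act_simpleK.
move=> bP; have [pos|neg] := root_sign bP.
  by have [n] := height_bound bP; apply: pos_orbit.
have NbP : - b \in Phi.
  by rewrite -refl_root ?root_nz // (root_refl rsP).
have [n ltn] := height_bound NbP.
have [i [g [gS gE]]] := pos_orbit n _ NbP neg ltn.
exists i, (s i * g)%g; rewrite groupM // repM mulmxA act_simple.
by rewrite refl_root ?root_nz ?simple_root // mulNmx -gE opprK.
Qed.

Lemma reflections_simple c :
  c \in reflections Phi rW <-> exists i g, c = (s i ^ g)%g.
Proof.
rewrite inE; split=> [/hasP[a aP /eqP cE] | [i [g ->]]].
  have [i [g [_ aE]]] := root_orbit aP; exists i, g; apply: rep_inj.
  by rewrite (rep_refl_conj _ (sE i)) cE aE.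
apply/hasP; exists (tnth Delta i *m rW g); first exact/root_act/simple_root.
by rewrite (rep_refl_conj _ (sE i)).
Qed.

Lemma simple_gen : <<[set s i | i : 'I_m]>>%g = [set: W].
Proof.
apply/eqP; rewrite eqEsubset subsetT; case: wgP => _ _ <-.
rewrite gen_subG; apply/subsetP=> c; rewrite inE => /hasP[a aP /eqP cE].
have [i [g [gS aE]]] := root_orbit aP.
suff -> : c = (s i ^ g)%g by rewrite groupJ // mem_gen ?imset_f.
by apply: rep_inj; rewrite (rep_refl_conj _ (sE i)) cE aE.
Qed.

Lemma weyl_half_spaces :
  half_spaces s (fun i g => positive (tnth Delta i *m rW g)).
Proof.
split=> [i||i|i g pos|i j g pos npos].
- exact: simple_invol.
- exact: simple_gen.
- by rewrite repr_mx1 mulmx1 positive_simple.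
- rewrite repM mulmxA act_simple refl_root ?root_nz ?simple_root // mulNmx.
  by rewrite positiveN // root_act ?simple_root.
suff gE : tnth Delta i *m rW g = tnth Delta j.
  suff -> : s j = (s i ^ g)%g by rewrite conjgE mulKVg.
  by apply: rep_inj; rewrite (rep_refl_conj _ (sE i)) gE sE.
apply: simple_refl_positive => //; first exact/root_act/simple_root.
by rewrite -act_simple -mulmxA -repM.
Qed.

Hypothesis slP : simply_laced Delta.

(** The use of simple lacing: if the product of the two Cartan numbers of a and b is
    1, then the reflections in b and then in a map a to - cartan a b *: b, and
    reflections depend only on the line of the root. *)
Lemma adj_simple_conj i j : dynkin_adj Delta i j -> exists g, (s i ^ g)%g = s j.
Proof.
case/andP=> ne_ij; case: (slP ne_ij) => [->|]; first by rewrite eqxx.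
rewrite /dynkin_bonds => c1 _; exists (s j * s i)%g; apply: rep_inj.
rewrite (rep_refl_conj _ (sE i)) repM mulmxA !act_simple sE.
set a := tnth Delta i in c1 *; set b := tnth Delta j in c1 *.
have a0 : a != 0 by apply/root_nz/simple_root.
have -> : refl a (refl b a) = - cartan a b *: b.
  rewrite {2}/refl linearB linearZ /= refl_root // {1}/refl scalerBr scalerA c1.
  by rewrite scale1r opprB addrA addNr add0r scaleNr.
have cN0 : - cartan a b != 0.
  by rewrite oppr_eq0; apply: contra_eqN c1 => /eqP->; rewrite mul0r eq_sym oner_eq0.
by apply/row_matrixP=> l; rewrite !rowE !mul_refl_mx refl_scale.
Qed.

Lemma simple_one_class : dynkin_connected Delta ->
  forall i j, exists g, (s i ^ g)%g = s j.
Proof.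
case=> _ conn i j; have /connectP[p] := conn i j.
elim: p i => [|l p IHp] i /= => [_ ->|/andP[il pathp] jE].
  by exists 1%g; rewrite conjg1.
have [g <-] := IHp _ pathp jE; have [h <-] := adj_simple_conj il.
by exists (h * g)%g; rewrite conjgM.
Qed.

End SimpleReflections.

Lemma H1_weyl (k : fieldType) : 2%N \notin [pchar k] ->
  simply_laced Delta -> dynkin_connected Delta ->
  H1_spanned_by_theta k (reflections Phi rW) /\
  \dim {: H1dR k (reflections Phi rW)} = 1%N.
Proof.
move=> char_k sl conn; have [s sE] : exists s : 'I_m -> W,
    forall i, rW (s i) = lin1_mx (refl (tnth Delta i)).
  apply: (@fin_all_exists _ (fun=> W)
    (fun i g => rW g = lin1_mx (refl (tnth Delta i)))) => i.
  by case: wgP => _ ex _; apply/ex/simple_root.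
have [spanned dim1] := H1_half_spaces char_k (weyl_half_spaces sE)
  (simple_one_class sE sl conn) (reflections_simple sE).
split=> //; apply: dim1; have [m_gt0 _] := conn.
exists (s (Ordinal m_gt0)); apply/(reflections_simple sE).
by exists (Ordinal m_gt0), 1%g; rewrite conjg1.
Qed.

End Weyl.

Theorem mainTheorem5 (k : fieldType) (char_k : 2%N \notin [pchar k]) :
  (forall (R : realFieldType) (m : nat) (Phi : seq 'rV[R]_m)
      (Delta : m.-tuple 'rV[R]_m) (W : finGroupType)
      (rW : mx_representation R [set: W] m),
    root_system Phi -> root_base Phi Delta ->
    simply_laced Delta -> dynkin_connected Delta ->
    is_weyl_group Phi rW ->
    H1_spanned_by_theta k (reflections Phi rW) /\
    \dim {: H1dR k (reflections Phi rW)} = 1%N)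
  /\
  (forall n : nat,
    H1_spanned_by_theta k (two_cycles n) /\
    ((2 <= n)%N -> \dim {: H1dR k (two_cycles n)} = 1%N)).
Proof.
split=> [R m Phi Delta W rW rsP rbP sl conn wgP | n].
  exact: (H1_weyl rsP rbP wgP).
exact: H1_symmetric.
Qed.
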